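(* Let $M_1,\dots,M_n$ be $d\times d$ complex matrices such that $\mathcal S=\{(I\otimes M_k)|\Phi\rangle\}_{k=1}^n\subseteq\mathbb C^d\otimes\mathbb C^d$ is a family of states (unit vectors) that has a simultaneous Schmidt decomposition. Then the following statements are equivalent: (1) the states in $\mathcal S$ are perfectly distinguishable by one-way LOCC; (2) the states in $\mathcal S$ are perfectly distinguishable by arbitrary operations; (3) there exists a $d\times d$ unitary matrix $A$ such that $\Delta(A^*M_j^*M_iA)=0$ whenever $i\neq j$.
   Context: $|\Phi\rangle=\frac1{\sqrt d}\sum_{k=0}^{d-1}|k\rangle\otimes|k\rangle\in\mathbb C^d\otimes\mathbb C^d$ is the standard maximally entangled state; the first tensor factor is Alice's system, the second is Bob's. $\Delta$ is the linear map on square matrices which replaces all off-diagonal entries by zero and leaves the diagonal entries unchanged. The family $\{(I\otimes M_k)|\Phi\rangle\}_{k=1}^n$ has a simultaneous Schmidt decomposition if there exist two $d\times d$ unitary matrices $U,V$ and complex diagonal matrices $D_1,\dots,D_n$ such that $M_k=UD_kV$ for each $k$ (the entries of $D_k$ need not be nonnegative). A family of states (unit vectors) $|\psi_1\rangle,\dots,|\psi_n\rangle\in\mathbb C^d\otimes\mathbb C^d$ is perfectly distinguishable by one-way LOCC if there are finitely many positive semidefinite operators $A_k$ and $B_{k,j}$ ($1\le j\le n$) on $\mathbb C^d$ with $\sum_kA_k=I$ and $\sum_jB_{k,j}=I$ for each $k$, such that $\langle\psi_i|A_k\otimes B_{k,j}|\psi_i\rangle=0$ for all $k$ and all $i\neq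 j$. It is perfectly distinguishable by arbitrary operations if there are positive semidefinite operators $E_1,\dots,E_n$ on $\mathbb C^d\otimes\mathbb C^d$ with $\sum_jE_j=I$ and $\langle\psi_i|E_j|\psi_i\rangle=0$ for all $i\ne j$ (equivalently, the states are mutually orthogonal). *)

(* Defs.v *)
From mathcomp Require Import all_boot all_order all_algebra.
From mathcomp Require Export complex mxtens.

Set Implicit Arguments.
Unset Strict Implicit.
Unset Printing Implicit Defensive.

Import Order.TTheory GRing.Theory Num.Theory Num.Def.
Local Open Scope ring_scope.
Local Open Scope sesquilinear_scope.

Section Definitions.
Variable C : numClosedFieldType.

(* [<psi| A |psi>], a scalar. *)
Definition expectation N (psi : 'cV[C]_N) (A : 'M[C]_N) : C :=
  (psi^t* *m A *m psi) 0 0.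

Definition unit_vector N (psi : 'cV[C]_N) : Prop := (psi^t* *m psi) 0 0 = 1.

(* [0 <= z] in a [numClosedFieldType] entails that [z] is real, so that
   Hermitian symmetry of [A] need not be required separately. *)
Definition psd N (A : 'M[C]_N) : Prop :=
  forall v : 'cV[C]_N, 0 <= expectation v A.

(* The tensor product of two column vectors has type ['M_(d * e, 1 * 1)],
   which is convertible to ['cV_(d * e)]. *)
Definition tensv d e (u : 'cV[C]_d) (v : 'cV[C]_e) : 'cV[C]_(d * e) := u *t v.

Definition max_entangled d : 'cV[C]_(d * d) :=
  (sqrtC d%:R)^-1 *: \sum_(k < d) tensv (delta_mx k 0) (delta_mx k 0).

Definition state_of_mx d (M : 'M[C]_d) : 'cV[C]_(d * d) :=
  ((1%:M : 'M[C]_d) *t M) *m max_entangled d.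

Definition diag_part d (A : 'M[C]_d) : 'M[C]_d :=
  \matrix_(i, j) (if i == j then A i j else 0).

(* The property of the family [(I (x) M_k)|Phi>] is expressed on the [M_k]. *)
Definition has_simultaneous_schmidt d n (M : 'I_n -> 'M[C]_d) : Prop :=
  exists (U V : 'M[C]_d) (D : 'I_n -> 'M[C]_d),
    [/\ U \is unitarymx, V \is unitarymx,
        forall k, is_diag_mx (D k)
      & forall k, M k = U *m D k *m V].

Definition one_way_LOCC_distinguishable d n
    (psi : 'I_n -> 'cV[C]_(d * d)) : Prop :=
  exists (m : nat) (A : 'I_m -> 'M[C]_d) (B : 'I_m -> 'I_n -> 'M[C]_d),
    [/\ (forall k, psd (A k)) /\ \sum_k A k = 1%:M,
        forall k j, psd (B k j),
        forall k, \sum_j B k j = 1%:M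
      & forall k i j, i != j -> expectation (psi i) (A k *t B k j) = 0].

Definition distinguishable d n (psi : 'I_n -> 'cV[C]_(d * d)) : Prop :=
  exists E : 'I_n -> 'M[C]_(d * d),
    [/\ forall j, psd (E j),
        \sum_j E j = 1%:M
      & forall i j, i != j -> expectation (psi i) (E j) = 0].

End Definitions.

(* Main.v *)
(* With M_k = U D_k V, every M_j^* M_i equals V^* G V with G diagonal, and
   tr G / d is the inner product of the j-th and i-th states.  If the states are
   orthogonal, then tr G = 0, and conjugating G by a unitary F whose entries all
   have modulus 1 / sqrt d spreads the trace evenly over the diagonal, which
   therefore vanishes: A = V^* F works.
   Conversely, given A, Alice measures in the (conjugated) basis of the columns
   a_k of A; outcome k leaves Bob with one of the vectors M_i a_k, which are
   pairwise orthogonal since the k-th diagonal entries of A^* M_j^* M_i A vanish,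
   so that Bob can discriminate them by projections. *)
Require Import Defs.
From mathcomp Require Import all_boot all_order all_algebra.
From mathcomp Require Import separable cyclotomic ring.
From mathcomp Require Import reals.

Set Implicit Arguments.
Unset Strict Implicit.
Unset Printing Implicit Defensive.

Import Order.TTheory GRing.Theory Num.Theory Num.Def.
Local Open Scope ring_scope.
Local Open Scope sesquilinear_scope.

Section Discrimination.
Variable C : numClosedFieldType.

(** * The sesquilinear form attached to a matrix *)

Definition sandwich N (u : 'cV[C]_N) (A : 'M[C]_N) (v : 'cV[C]_N) : C :=
  (u^t* *m A *m v) 0 0.

Lemma adjmxM m n p (A : 'M[C]_(m, n)) (B : 'M[C]_(n, p)) :
  (A *m B)^t* = B^t* *m A^t*.
Proof. by rewrite trmx_mul map_mxM. Qed.

Lemma sandwichDl N (A : 'M[C]_N) u v w :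
  sandwich (u + v) A w = sandwich u A w + sandwich v A w.
Proof. by rewrite /sandwich linearD map_mxD !mulmxDl mxE. Qed.

Lemma sandwichDr N (A : 'M[C]_N) u v w :
  sandwich u A (v + w) = sandwich u A v + sandwich u A w.
Proof. by rewrite /sandwich mulmxDr mxE. Qed.

Lemma sandwichZl N (A : 'M[C]_N) a u v :
  sandwich (a *: u) A v = a^* * sandwich u A v.
Proof. by rewrite /sandwich linearZ map_mxZ -!scalemxAl mxE. Qed.

Lemma sandwichZr N (A : 'M[C]_N) a u v :
  sandwich u A (a *: v) = a * sandwich u A v.
Proof. by rewrite /sandwich -scalemxAr mxE. Qed.

Lemma sandwich_suml N I (r : seq I) (P : pred I) (F : I -> 'cV[C]_N)
    (A : 'M[C]_N) v :
  sandwich (\sum_(i <- r | P i) F i) A v =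
  \sum_(i <- r | P i) sandwich (F i) A v.
Proof.
by rewrite /sandwich linear_sum map_mx_sum !mulmx_suml summxE.
Qed.

Lemma sandwich_sumr N I (r : seq I) (P : pred I) (F : I -> 'cV[C]_N)
    (A : 'M[C]_N) u :
  sandwich u A (\sum_(i <- r | P i) F i) =
  \sum_(i <- r | P i) sandwich u A (F i).
Proof. by rewrite /sandwich mulmx_sumr summxE. Qed.

Lemma sandwich_summ N I (r : seq I) (P : pred I) (F : I -> 'M[C]_N) u v :
  sandwich u (\sum_(i <- r | P i) F i) v =
  \sum_(i <- r | P i) sandwich u (F i) v.
Proof. by rewrite /sandwich mulmx_sumr mulmx_suml summxE. Qed.

Lemma sandwich_delta N (A : 'M[C]_N) i j :
  sandwich (delta_mx i 0) A (delta_mx j 0) = A i j.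
Proof.
by rewrite /sandwich trmx_delta map_delta_mx -rowE -colE !mxE.
Qed.

(** * Positive semidefinite operators *)

Lemma psd_polar N (A : 'M[C]_N) (u v : 'cV[C]_N) : psd A ->
  sandwich v A u = (sandwich u A v)^*.
Proof.
move=> psdA; set a := sandwich u A v; set b := sandwich v A u.
(* Polarization: the form is real at [u + t *: v], at [u] and at [v], so the cross terms are real.
   Taking [t = 1] and [t = 'i] then forces [b = a^*]. *)
have im0 t : t * a + t^* * b \is Num.real.
  have : expectation (u + t *: v) A \is Num.real.
    by apply: ger0_real; apply: psdA.
  rewrite /expectation -/(sandwich _ _ _) sandwichDl !sandwichDr !sandwichZl.
  rewrite !sandwichZr -/a -/b => H.
  have -> : t * a + t^* * b =
      sandwich u A u + t * a + (t^* * b + t^* * (t * sandwich v A v))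
      - sandwich u A u - (t^* * t) * sandwich v A v by ring.
  rewrite !rpredB //; last 1 first.
    by rewrite rpredM // ger0_real // ?psdA // mulrC mul_conjC_ge0.
  by rewrite ger0_real // psdA.
have h1 := im0 1; have hi := im0 'i.
move: h1 hi; rewrite rmorph1 !mul1r conjCi mulNr -mulrBr.
move=> /CrealP h1 /CrealP hi.
move: h1; rewrite rmorphD /= => h1.
move: hi; rewrite rmorphM rmorphB /= conjCi mulNr -mulrN => /(mulfI (neq0Ci _)) hi.
have : (b *+ 2 == a^* *+ 2).
  have -> : b *+ 2 = (a + b) - (a - b) by ring.
  by rewrite -h1 -hi; apply/eqP; ring.
by rewrite eqrMn2r // => /eqP.
Qed.

Lemma psd_hermitian N (A : 'M[C]_N) : psd A -> A^t* = A.
Proof.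
move=> psdA; apply/matrixP => i j; rewrite !mxE -2!sandwich_delta.
by rewrite -psd_polar.
Qed.

Lemma psd_null N (A : 'M[C]_N) (u v : 'cV[C]_N) : psd A ->
  expectation v A = 0 -> sandwich u A v = 0.
Proof.
move=> psdA v0; set b := sandwich u A v; set c := sandwich u A u.
have c_ge0 : 0 <= c by apply: psdA.
have c1_gt0 : 0 < c + 1 by rewrite ltr_wpDl.
(* The added 1 covers the case [c = 0] and gives [s * c < 1], which is what makes the factor
   [s * c - 1 - 1] negative. *)
set s := (c + 1)^-1.
have s_gt0 : 0 < s by rewrite invr_gt0.
have sC : s^* = s by apply/CrealP; apply: gtr0_real.
(* Moving from v along - s b u changes the form by |b|^2 (s^2 c - 2 s), which is
   negative for this s unless b = 0. *)
have := psdA (v - (s * b) *: u).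
rewrite /expectation -/(sandwich _ _ _) -scaleNr sandwichDl !sandwichDr.
rewrite !sandwichZl !sandwichZr (psd_polar u v psdA) [sandwich v A v]v0 -/b.
rewrite rmorphN rmorphM /= sC -/c.
set t := (X in 0 <= X).
have -> : t = (b * b^*) * (s * (s * c - 1 - 1)) by rewrite /t; ring.
have sc_lt0 : s * c - 1 - 1 < 0.
  rewrite subr_lt0 ltrBlDr; apply: (@lt_trans _ _ 1); last by rewrite ltrDl.
  by rewrite mulrC ltr_pdivrMr // mul1r ltrDl.
rewrite nmulr_lge0 ?pmulr_rlt0 // => bb_le0; apply/eqP.
by rewrite -normr_eq0 -sqrf_eq0 normCK eq_le bb_le0 mul_conjC_ge0.
Qed.

Lemma psd_gram m N (X : 'M[C]_(m, N)) : psd (X^t* *m X).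
Proof.
move=> v; rewrite /expectation mulmxA -adjmxM -mulmxA mxE sumr_ge0 // => k _.
by rewrite !mxE mulrC mul_conjC_ge0.
Qed.

(** By the spectral theorem [A] is [U^t* *m diag_mx s *m U]. The eigenvalues are values of the form
    at eigenvectors, hence nonnegative, and their square roots give [X]. *)
Lemma psd_gramP N (A : 'M[C]_N) : psd A -> exists X : 'M[C]_N, A = X^t* *m X.
Proof.
move=> psdA.
have /orthomx_spectralP : A \is normalmx.
  by apply/normalmxP; rewrite psd_hermitian.
set U := spectralmx A; set s := spectral_diag A.
have U_unit : U \is unitarymx := spectral_unitarymx A.
rewrite invmx_unitary // => defA.
have s_ge0 i : 0 <= s 0 i.
  have := psdA (U^t* *m delta_mx i 0); rewrite /expectation defA adjmxM trmxCK.
  rewrite !mulmxA mulmxtVK // -!mulmxA [U *m _]mulmxA (unitarymxP U_unit) mul1mx.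
  rewrite !mulmxA -/(sandwich _ _ _).
  by rewrite (sandwich_delta (diag_mx s)) mxE eqxx.
exists (diag_mx (map_mx sqrtC s) *m U).
rewrite {1}defA adjmxM !mulmxA; congr (_ *m _); rewrite -mulmxA; congr (_ *m _).
rewrite tr_diag_mx map_diag_mx mulmx_diag; congr diag_mx; apply/rowP => i.
rewrite !mxE /= conj_Creal ?ger0_real ?sqrtC_ge0 //.
by rewrite -expr2 sqrtCK.
Qed.

(** Gram factors [X] and [Y] of the two operators yield the Gram factor [X *t Y] of their tensor
    product. *)
Lemma psd_tens m n (A : 'M[C]_m) (B : 'M[C]_n) : psd A -> psd B -> psd (A *t B).
Proof.
move=> /psd_gramP[X ->] /psd_gramP[Y ->].
by rewrite -tensmx_mul -map_mxT -trmx_tens; apply: psd_gram.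
Qed.

Lemma psd_sum N I (r : seq I) (P : pred I) (F : I -> 'M[C]_N) :
  (forall i, P i -> psd (F i)) -> psd (\sum_(i <- r | P i) F i).
Proof.
move=> psdF v; rewrite /expectation -/(sandwich _ _ _) sandwich_summ.
by apply: sumr_ge0 => i /psdF; apply.
Qed.


(** * Tensor products and the states defined by matrices *)

Lemma tensmx11 m n : (1%:M : 'M[C]_m) *t (1%:M : 'M[C]_n) = 1%:M.
Proof.
apply/matrixP => i j; rewrite !mxE -natrM mulnb; congr (_%:R).
by rewrite -(can_eq (@mxtens_unindexK m n) i j).
Qed.

Lemma tensmx_suml m n p q I (r : seq I) (P : pred I) (F : I -> 'M[C]_(m, n))
    (B : 'M[C]_(p, q)) :
  (\sum_(i <- r | P i) F i) *t B = \sum_(i <- r | P i) (F i *t B).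
Proof.
apply/matrixP => i j; rewrite mxE !summxE mulr_suml.
by apply: eq_bigr => k _; rewrite mxE.
Qed.

Lemma tensmx_sumr m n p q I (r : seq I) (P : pred I) (A : 'M[C]_(m, n))
    (F : I -> 'M[C]_(p, q)) :
  A *t (\sum_(i <- r | P i) F i) = \sum_(i <- r | P i) (A *t F i).
Proof.
apply/matrixP => i j; rewrite mxE !summxE mulr_sumr.
by apply: eq_bigr => k _; rewrite mxE.
Qed.

Lemma state_of_mxE d (M : 'M[C]_d) :
  state_of_mx M =
  (sqrtC d%:R)^-1 *: \sum_(k < d) tensv (delta_mx k 0) (M *m delta_mx k 0).
Proof.
rewrite /state_of_mx /max_entangled -scalemxAr mulmx_sumr.
congr (_ *: _); apply: eq_bigr => k _.
have := tensmx_mul 1%:M M (delta_mx k 0 : 'cV_d) (delta_mx k 0 : 'cV_d).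
by rewrite mul1mx.
Qed.

Lemma sandwich_tens d e (u u' : 'cV[C]_d) (v v' : 'cV[C]_e) A B :
  sandwich (tensv u v) (A *t B) (tensv u' v') =
  sandwich u A u' * sandwich v B v'.
Proof.
have -> : sandwich (tensv u v) (A *t B) (tensv u' v') =
    ((u^t* *m A *m u') *t (v^t* *m B *m v')) 0 0.
  by rewrite -!tensmx_mul -map_mxT -trmx_tens.
by rewrite mxE !ord1.
Qed.

(** The double sum is the trace of [A^T *m (M^t* *m B *m N)]: on the maximally entangled state,
    Alice's operator acts on Bob's side through its transpose. *)
Lemma sandwich_state d (M N A B : 'M[C]_d) :
  sandwich (state_of_mx M) (A *t B) (state_of_mx N) =
  d%:R^-1 * \sum_k \sum_l A k l * (M^t* *m B *m N) k l.
Proof.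
rewrite !state_of_mxE sandwichZl sandwichZr mulrA; congr (_ * _).
  rewrite conj_Creal ?rpredV ?ger0_real ?sqrtC_ge0 ?ler0n //.
  by rewrite -invfM -expr2 sqrtCK.
rewrite sandwich_suml; apply: eq_bigr => k _.
rewrite sandwich_sumr; apply: eq_bigr => l _.
rewrite sandwich_tens sandwich_delta; congr (_ * _).
by rewrite -[RHS]sandwich_delta /sandwich adjmxM !mulmxA.
Qed.

Lemma inner_state d (M N : 'M[C]_d) :
  sandwich (state_of_mx M) 1%:M (state_of_mx N) = d%:R^-1 * \tr (M^t* *m N).
Proof.
rewrite -tensmx11 sandwich_state mulmx1; congr (_ * _); apply: eq_bigr => k _.
rewrite (bigD1 k) //= big1 => [|l]; first by rewrite mxE eqxx mul1r addr0.
by rewrite mxE eq_sym => /negPf->; rewrite mul0r.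
Qed.

(** * Projective discrimination of orthogonal vectors *)

Lemma perfect_discrimination N n (x : 'I_n -> 'cV[C]_N) : (0 < n)%N ->
  (forall i j, i != j -> (x i)^t* *m x j = 0) ->
  exists B : 'I_n -> 'M[C]_N,
    [/\ forall j, psd (B j), \sum_j B j = 1%:M
      & forall i j, i != j -> expectation (x i) (B j) = 0].
Proof.
case: n x => // n x _ orth_x.
pose a i := (x i)^t* *m x i.
(* The projector on [x i]; it is 0 when [x i = 0] since then [a i 0 0]^-1 = 0. *)
pose P i := ((a i 0 0)^-1) *: (x i *m (x i)^t*).
(* Outcome [ord0] gets everything outside the other projectors, which completes the measurement even
   when the [x i] do not span the space. *)
pose Q := 1%:M - \sum_(j | j != ord0) P j.
have a_ge0 i : 0 <= a i 0 0.
  have := psd_gram (1%:M : 'M[C]_N) (x i).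
  by rewrite /expectation mulmx1 trmx1 map_mx1 mulmx1.
have aE i : a i = (a i 0 0)%:M by rewrite -mx11_scalar.
have ax i : x i *m a i = a i 0 0 *: x i by rewrite aE mul_mx_scalar !mxE eqxx.
have Padj i : (P i)^t* = P i.
  rewrite /P linearZ map_mxZ adjmxM trmxCK; congr (_ *: _).
  by rewrite /= conj_Creal // rpredV ger0_real.
have x0 i : a i 0 0 = 0 -> x i = 0.
  move=> ai0; apply/matrixP => k l; rewrite (ord1 l) [RHS]mxE.
  move: ai0; rewrite /a mxE => /eqP; rewrite psumr_eq0; last first.
    by move=> j _; rewrite !mxE mulrC mul_conjC_ge0.
  move=> /allP/(_ k (mem_index_enum _)); rewrite !mxE mulrC /= -normCK.
  by rewrite sqrf_eq0 normr_eq0 => /eqP.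
have Px i : P i *m x i = x i.
  rewrite /P -scalemxAl -mulmxA -/(a i) ax scalerA.
  have [ai0|ai0] := eqVneq (a i 0 0) 0; last by rewrite mulVf ?scale1r.
  by rewrite (x0 _ ai0) scaler0.
have Px0 i j : j != i -> P j *m x i = 0.
  by move=> ji; rewrite /P -scalemxAl -mulmxA orth_x // mulmx0 scaler0.
have PP i : P i *m P i = P i by rewrite {2}/P -scalemxAr mulmxA Px.
have PP0 i j : i != j -> P i *m P j = 0.
  by move=> ij; rewrite {2}/P -scalemxAr mulmxA Px0 // mul0mx scaler0.
have Qx i : i != ord0 -> Q *m x i = 0.
  move=> i0; rewrite mulmxBl mul1mx mulmx_suml (bigD1 i) //= Px.
  rewrite big1 ?addr0 ?subrr //.
  by move=> j /andP[_ ji]; rewrite Px0.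
(* [Q] is Hermitian and kills every [P j] with [j != ord0], so it is idempotent; being a Gram
   matrix, it is positive. *)
have QQ : Q = Q^t* *m Q.
  have -> : Q^t* = Q.
    rewrite /Q linearB /= map_mxB trmx1 map_mx1 linear_sum map_mx_sum.
    by congr (_ - _); apply: eq_bigr => j _; rewrite Padj.
  rewrite {3}/Q mulmxBr mulmx1 mulmx_sumr big1 ?subr0 // => j j0.
  by rewrite /P -scalemxAr mulmxA Qx // mul0mx scaler0.
exists (fun j => if j == ord0 then Q else P j); split.
- move=> j; case: ifP => _; first by rewrite QQ; apply: psd_gram.
  by rewrite -PP -{1}Padj; apply: psd_gram.
- by rewrite (bigD1 ord0) //= (eq_bigr P) ?subrK // => j /negPf->.
- move=> i j ij; rewrite /expectation; case: ifP => [/eqP j0|_].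
    by rewrite -mulmxA Qx -?j0 // mulmx0 mxE.
  by rewrite -mulmxA Px0 1?eq_sym // mulmx0 mxE.
Qed.

(** * Roots of unity and a Fourier matrix *)

Lemma distinct_unity_roots d : (0 < d)%N ->
  exists r : 'I_d -> C, injective r /\ forall i, r i ^+ d = 1.
Proof.
move=> d_gt0; pose p : {poly C} := 'X^d - 1.
have [r] := closed_field_poly_normal p.
rewrite (monicP _) ?monicXnsubC // scale1r => Dp.
have size_r : size r = d.
  by apply: succn_inj; rewrite -(size_prod_XsubC r id) -Dp size_XnsubC.
(* The polynomial is separable because [d] is nonzero in [C]. *)
have uniq_r : uniq r.
  by rewrite -separable_prod_XsubC -Dp separable_Xn_sub_1 // pnatr_eq0 -lt0n.
exists (fun i => r`_i); split=> [i j /eqP|i].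
  by rewrite nth_uniq ?size_r // => /eqP/val_inj.
apply/eqP; rewrite -unity_rootE /root_of_unity -/p Dp root_prod_XsubC.
by rewrite mem_nth ?size_r.
Qed.

Lemma flat_unitary_exists d : (0 < d)%N ->
  exists2 F : 'M[C]_d,
    F \is unitarymx & forall k l, (F k l)^* * F k l = d%:R^-1.
Proof.
move=> d_gt0; have [r [r_inj r_unity]] := distinct_unity_roots d_gt0.
have d_neq0 : d%:R != 0 :> C by rewrite pnatr_eq0 -lt0n.
pose c : C := (sqrtC d%:R)^-1.
have cc : c * c^* = d%:R^-1.
  rewrite conj_Creal ?rpredV ?ger0_real ?sqrtC_ge0 ?ler0n //.
  by rewrite -invfM -expr2 sqrtCK.
have rr i : r i * (r i)^* = 1.
  rewrite -normCK; apply/eqP; rewrite sqrp_eq1 // -(pexpr_eq1 d_gt0) //.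
  by rewrite -normrX r_unity normr1.
(* The Vandermonde matrix of the d-th roots of unity, suitably scaled. *)
pose F : 'M[C]_d := \matrix_(i, k) (c * r i ^+ k).
have FE i j k : F i k * (F j k)^* = d%:R^-1 * (r i * (r j)^*) ^+ k.
  by rewrite !mxE rmorphM rmorphXn mulrACA cc exprMn.
exists F; last by move=> k l; rewrite mulrC FE rr expr1n mulr1.
apply/unitarymxP/matrixP => i j; rewrite !mxE.
under eq_bigr do rewrite ![_^t* _ _]mxE [_^T _ _]mxE FE.
rewrite -mulr_sumr.
have [<-|ij] := eqVneq i j.
  under eq_bigr do rewrite rr expr1n.
  by rewrite sumr_const card_ord mulVf.
(* An off-diagonal entry of [F *m F^t*] is a multiple of the geometric sum of the powers of [w],
   which vanishes as [w ^+ d = 1] and [w != 1]. *)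
set w := r i * (r j)^*.
have w_neq1 : w - 1 != 0.
  rewrite subr_eq0; apply: contra ij => /eqP w1; apply/eqP/r_inj.
  by rewrite -[r i]mulr1 -(rr j) mulrCA mulrC -/w w1 mul1r.
have : (w - 1) * (\sum_(k < d) w ^+ k) = 0.
  by rewrite -subrX1 exprMn -rmorphXn !r_unity rmorph1 mulr1 subrr.
by move/eqP; rewrite mulf_eq0 (negPf w_neq1) => /eqP ->; rewrite mulr0.
Qed.

(** * From measurements to orthogonality, and Alice's rank-one outcomes *)

Lemma one_way_LOCC_distinguishableW d n (psi : 'I_n -> 'cV[C]_(d * d)) :
  one_way_LOCC_distinguishable psi -> distinguishable psi.
Proof.
move=> [m [A [B [[psdA sumA] psdB sumB AB0]]]].
(* The global operator for [j] collects all branches in which Bob announces [j]. *)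
exists (fun j => \sum_k A k *t B k j); split=> [j||i j ij].
- by apply: psd_sum => k _; apply: psd_tens.
- rewrite exchange_big /= -tensmx11 -{1}sumA tensmx_suml.
  by apply: eq_bigr => k _; rewrite -tensmx_sumr sumB.
- rewrite /expectation -/(sandwich _ _ _) sandwich_summ big1 // => k _.
  exact: AB0.
Qed.

(** Insert the identity as the sum of the [E k]. Each [k] differs from [i] or from [j], so [E k] has
    zero expectation in one of the two states, and positivity makes the cross term vanish. *)
Lemma distinguishable_orthogonal N n (psi : 'I_n -> 'cV[C]_N) i j
    (E : 'I_n -> 'M[C]_N) :
  (forall k, psd (E k)) -> \sum_k E k = 1%:M ->
  (forall k l, k != l -> expectation (psi k) (E l) = 0) ->
  i != j -> sandwich (psi j) 1%:M (psi i) = 0.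
Proof.
move=> psdE sumE E0 ij; rewrite -sumE sandwich_summ big1 // => k _.
have [->|ki] := eqVneq k i; last by apply: psd_null; rewrite // E0 // eq_sym.
by rewrite psd_polar // psd_null ?rmorph0 // E0 // eq_sym.
Qed.

Lemma diag_conj_flat d (F : 'M[C]_d) (g : 'rV[C]_d) i :
  (forall k l, (F k l)^* * F k l = d%:R^-1) ->
  (F^t* *m diag_mx g *m F) i i = d%:R^-1 * \tr (diag_mx g).
Proof.
move=> F_flat; rewrite -mulmxA mul_diag_mx mxE mulr_sumr.
by apply: eq_bigr => k _; rewrite !mxE eqxx mulrCA F_flat mulrC.
Qed.

(** Alice's operator is the transpose of [a *m a^t*], which undoes the transposition caused by the
    entangled state: Bob is left with the unnormalized vector [M *m a]. *)
Lemma sandwich_state_rank1 d (a : 'cV[C]_d) (M B : 'M[C]_d) :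
  expectation (state_of_mx M) ((a^T)^t* *m a^T *t B) =
  d%:R^-1 * expectation (M *m a) B.
Proof.
rewrite [LHS]sandwich_state; congr (_ * _).
have -> : expectation (M *m a) B = sandwich a (M^t* *m B *m M) a.
  by rewrite /expectation /sandwich adjmxM !mulmxA.
move: (_ *m M) => X; rewrite /sandwich -mulmxA mxE; apply: eq_bigr => k _.
rewrite !mxE mulr_sumr; apply: eq_bigr => l _.
by rewrite !mxE big_ord1 !mxE -mulrA [a l 0 * _]mulrC.
Qed.

End Discrimination.

Local Open Scope complex_scope.
Local Open Scope sesquilinear_scope.

Theorem proposition3 (R : realType) (d n : nat) (M : 'I_n -> 'M[R[i]]_d)
    (n_gt0 : (0 < n)%N)
    (M_unit : forall k, unit_vector (state_of_mx (M k)))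
    (M_schmidt : has_simultaneous_schmidt M) :
  [<-> one_way_LOCC_distinguishable (fun k => state_of_mx (M k));
       distinguishable (fun k => state_of_mx (M k));
       exists A : 'M[R[i]]_d,
         A \is unitarymx /\
         forall i j : 'I_n, i != j ->
           diag_part (A^t* *m (M j)^t* *m M i *m A) = 0].
Proof.
tfae.
- exact: one_way_LOCC_distinguishableW.
- move=> [E [psdE sumE E0]].
  (* A zero-dimensional space has no unit vector, while the family has at least one member. *)
  have d_gt0 : (0 < d)%N.
    case: d M E {M_schmidt psdE sumE E0} M_unit => // M _ /(_ (Ordinal n_gt0)).
    by rewrite /unit_vector mxE big_ord0 => /esym/eqP; rewrite oner_eq0.
  have [U [V [D [U_unit V_unit D_diag defM]]]] := M_schmidt.
  have [F F_unit F_flat] := flat_unitary_exists R[i] d_gt0.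
  exists (V^t* *m F); split=> [|i j ij].
    by rewrite mul_unitarymx // trmxC_unitary.
  have [g gramE] : exists g, (M j)^t* *m M i = V^t* *m diag_mx g *m V.
    have [/diag_mxP[ej Dj] /diag_mxP[ei Di]] := (D_diag j, D_diag i).
    have UU : U^t* *m U = 1%:M.
      by move: U_unit; rewrite -trmxC_unitary => /unitarymxP; rewrite trmxCK.
    exists (\row_k ((map_mx conjC ej) 0 k * ei 0 k)).
    rewrite !defM Dj Di !adjmxM -!mulmxA (mulmxA _ U) UU mul1mx.
    by rewrite tr_diag_mx map_diag_mx (mulmxA (diag_mx _)) mulmx_diag.
  have VV : V *m V^t* = 1%:M by apply/unitarymxP.
  (* Cyclicity of the trace removes [V], so this is the inner product of the two states. *)
  have tr0 : d%:R^-1 * \tr (diag_mx g) = 0.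
    rewrite -(distinguishable_orthogonal psdE sumE E0 ij) inner_state gramE.
    by rewrite mxtrace_mulC mulmxA VV mul1mx.
  apply/matrixP => k l; rewrite [RHS]mxE mxE; case: eqP => // <-.
  rewrite -(mulmxA _ _ (M i)) gramE adjmxM trmxCK !mulmxA.
  rewrite mulmxtVK // -(mulmxA _ V) VV mulmx1.
  by rewrite diag_conj_flat.
- move=> [A [A_unit A0]].
  (* This inner product is the [(k, k)] entry of [A^t* *m (M i)^t* *m M j *m A]; the roles of [i]
     and [j] are exchanged with respect to [A0]. *)
  have orth k i j : i != j -> (M i *m col k A)^t* *m (M j *m col k A) = 0.
    rewrite eq_sym => /A0/matrixP/(_ k k); rewrite mxE eqxx [RHS]mxE => A0k.
    apply/matrixP => p q; rewrite !ord1 [RHS]mxE -A0k.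
    by rewrite -(sandwich_delta _ k k) /sandwich colE !adjmxM !mulmxA.
  have [B B_discr] : exists B : 'I_d -> 'I_n -> 'M[R[i]]_d, forall k,
      [/\ forall j, psd (B k j), \sum_j B k j = 1%:M
        & forall i j, i != j -> expectation (M i *m col k A) (B k j) = 0].
    exact: (fin_all_exists (fun k => perfect_discrimination n_gt0 (orth k))).
  (* Alice's outcome [k] leaves Bob, up to a factor, with [M i *m col k A] when
     her operator is the transpose of the projector on [col k A]. *)
  exists d, (fun k => ((col k A)^T)^t* *m (col k A)^T), B.
  split=> [|k|k|k i j ij]; try by have [] := B_discr k.
    split=> [k|]; first exact: psd_gram.
    (* Alice's operators sum to the transpose of [A *m A^t*], hence the swapped indices below. *)
    apply/matrixP => i j; rewrite summxE.
    move/unitarymxP/matrixP/(_ j i): A_unit; rewrite !mxE eq_sym => <-.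
    by apply: eq_bigr => k _; rewrite mxE big_ord1 !mxE mulrC.
  have [_ _ B0] := B_discr k.
  by rewrite sandwich_state_rank1 B0 // mulr0.
Qed.
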